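(* If $G$ is a graph of order $n \ge 60$ with minimum degree $\delta(G) \ge 3$, then $$\mathrm{pd}_{\frac{9}{10}}(G) \le \frac{1}{3}n.$$
   Context: Graphs are finite, simple and undirected (not necessarily connected); the order of a graph is its number of vertices. For a vertex $v$ of a graph $G$, $N_G[v]$ denotes the closed neighborhood of $v$ ($v$ together with all its neighbors), and for $S \subseteq V(G)$, $N_G[S] = \bigcup_{v\in S} N_G[v]$. For $0 < \alpha \le 1$ and a graph $G$ of order $n$, a set $S \subseteq V(G)$ is an $\alpha$-partial dominating set of $G$ if $|N_G[S]| \ge \alpha \times n$. The $\alpha$-partial domination number $\mathrm{pd}_{\alpha}(G)$ is the minimum cardinality of an $\alpha$-partial dominating set of $G$. *)

(* Defs.v *)
From mathcomp Require Import all_boot all_order all_algebra.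

Set Implicit Arguments.
Unset Strict Implicit.
Unset Printing Implicit Defensive.

Import Order.TTheory GRing.Theory Num.Theory.

Record sgraph := SGraph {
  vertex :> finType;
  adj : rel vertex;
  adj_sym : symmetric adj;
  adj_irrefl : irreflexive adj
}.

Definition degree (G : sgraph) (v : G) : nat := #|[set w : G | adj v w]|.

(* Every degree is less than #|G|, so the default value #|G| of the iterated
   minimum is only reached on the graph without vertices. *)
Definition min_degree (G : sgraph) : nat :=
  \big[minn/#|G|]_(v : G) degree v.

Definition closed_nbhd (G : sgraph) (v : G) : {set G} :=
  v |: [set w : G | adj v w].

Definition closed_nbhd_set (G : sgraph) (S : {set G}) : {set G} :=
  \bigcup_(v in S) closed_nbhd v.

Definition partial_dominating (R : realFieldType) (alpha : R) (G : sgraph)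
    (S : {set G}) : bool :=
  (alpha * #|G|%:R <= #|closed_nbhd_set S|%:R)%R.

(* For alpha <= 1 the full vertex set is alpha-partial dominating, so the
   minimum is over a nonempty family (see pd_attained and pd_le); the value
   is meaningless for alpha > 1. *)
Definition pd (R : realFieldType) (alpha : R) (G : sgraph) : nat :=
  #|arg_min [set: G] (fun S => partial_dominating alpha S)
            (fun S : {set G} => #|S|)|.

Lemma min_degree_le (G : sgraph) (v : G) : min_degree G <= degree v.
Proof.
rewrite /min_degree; have: v \in index_enum G by exact: mem_index_enum.
elim: (index_enum G) => [//|w s IHs]; rewrite inE big_cons geq_min.
by case/predU1P=> [<-|/IHs ->]; rewrite ?leqnn ?orbT.
Qed.

Lemma degree_lt (G : sgraph) (v : G) : degree v < #|G|.
Proof.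
rewrite /degree -cardsT; apply: proper_card; apply/properP; split.
  exact: subsetT.
by exists v; rewrite !inE ?adj_irrefl.
Qed.

Lemma min_degree_attained (G : sgraph) :
  0 < #|G| -> exists v : G, min_degree G = degree v.
Proof.
move=> /card_gt0P [v0 _].
have [v _ vmin] := @arg_minnP G v0 xpredT (@degree G) isT.
exists v; apply/eqP; rewrite eqn_leq min_degree_le /=.
rewrite /min_degree; elim/big_ind: _ => [|x y hx hy|w _].
- exact: ltnW (degree_lt v).
- by rewrite leq_min hx.
- exact: vmin.
Qed.

Lemma partial_dominatingT (R : realFieldType) (alpha : R) (G : sgraph) :
  (alpha <= 1)%R -> partial_dominating alpha [set: G].
Proof.
move=> ha; rewrite /partial_dominating.
have -> : closed_nbhd_set [set: G] = [set: G].
  by apply/setP=> v; rewrite !inE; apply/bigcupP; exists v; rewrite ?inE ?eqxx.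
by rewrite cardsT ler_piMl // ler0n.
Qed.

Lemma pd_attained (R : realFieldType) (alpha : R) (G : sgraph) :
  (alpha <= 1)%R ->
  exists2 S : {set G}, partial_dominating alpha S & #|S| = pd alpha G.
Proof.
move=> ha; rewrite /pd.
by case: arg_minnP => [|S hS _]; [exact: partial_dominatingT | exists S].
Qed.

Lemma pd_le (R : realFieldType) (alpha : R) (G : sgraph) (S : {set G}) :
  (alpha <= 1)%R -> partial_dominating alpha S -> pd alpha G <= #|S|.
Proof.
move=> ha hS; rewrite /pd.
by case: arg_minnP => [|S' _]; [exact: partial_dominatingT | exact].
Qed.

(* Main.v *)
Require Import Defs.
From mathcomp Require Import all_boot all_order all_algebra.
From mathcomp Require Import zify lra.

Set Implicit Arguments.
Unset Strict Implicit.
Unset Printing Implicit Defensive.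

Import Order.TTheory GRing.Theory Num.Theory.

(** Dominate greedily, always keeping track of the set U of vertices that are
not yet dominated, and measure the progress by a potential: an undominated
vertex has a large weight, and a dominated vertex y has a smaller weight that
depends on the number of undominated neighbours it still has (0, 1, 2, or at
least 3).  When v is picked, every vertex of N[v] in U loses the difference of
its two weights, and so do the dominated vertices around it, whose
undominated degree shrinks.  Minimum degree 3 guarantees that there are many
of the latter when an undominated vertex has few undominated neighbours.

Call U sparse when no pick dominates more than two new vertices.  While U is
not sparse, [exists_heavy_pick] finds a pick that dominates at least three new
vertices and lowers the potential by a prescribed amount, for every choice of
weights that satisfies a short list of linear inequalities.  The pick does not
depend on the weights, so two different potentials can bound the same run.
Let s1 be the number of picks made until the set U1 of the vertices left
undominated is sparse, put u1 = #|U1|, and let n be the order.  Then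
3 * s1 + u1 <= n, so s1 <= n / 3, and the two potentials, which start at
15 * n and 11 * n, give
- 42 * s1 + 21 * u1 <= 15 * n, that is 2 * s1 + u1 <= 5 * n / 7;
- 26 * s1 + P <= 11 * n, where P is the second potential of U1.

Now q - s1 picks remain, with q the integer part of n / 3.  They are spent on
picks that dominate two new vertices and lower the second potential by 26, as
long as there are any ([exists_pair_pick]).  If they last until the end, at
most u1 - 2 * (q - s1) <= 5 * n / 7 - 2 * q vertices stay undominated.
Otherwise a set remains whose vertices need one pick each and contribute 26
each to the second potential ([packing_full_potential]); if u of them are left
when the picks run out, then 26 * (u + q) <= 11 * n.  As the
number of undominated vertices is an integer, both bounds make it at most
n / 10 for n >= 60: the numbers 5/7 - 2/3 = 1/21 and 11/26 - 1/3 = 7/78 lie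
below 1/10, and the margin absorbs the rounding of n / 3. *)

(** * Undominated degrees *)

Definition nbhd (G : sgraph) (v : G) : {set G} := [set w | adj v w].

Definition deg_in (G : sgraph) (U : {set G}) (v : G) : nat := #|nbhd v :&: U|.

Lemma deg_in_setD (G : sgraph) (U X : {set G}) (v : G) :
  X \subset U -> deg_in U v = deg_in (U :\: X) v + deg_in X v.
Proof.
move=> /setIidPr XU; rewrite /deg_in -(cardsID X (nbhd v :&: U)) addnC.
by rewrite -setIA XU setIDA.
Qed.

Lemma deg_inC (G : sgraph) (v : G) (U : {set G}) :
  3 <= min_degree G -> 3 <= deg_in U v + deg_in (~: U) v.
Proof.
move=> hG; have := leq_trans hG (min_degree_le v).
by rewrite /degree -/(nbhd v) -(cardsID U) setDE.
Qed.

Lemma deg_in_double_count (G : sgraph) (A B : {set G}) :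
  \sum_(x in A) deg_in B x = \sum_(y in B) deg_in A y.
Proof.
have sumE (C D : {set G}) :
    \sum_(x in C) deg_in D x = \sum_(x in C) \sum_(y in D) adj x y.
  apply: eq_bigr => x _; rewrite /deg_in -sum1_card.
  rewrite (eq_bigl (fun y => (y \in D) && adj x y)); last first.
    by move=> y; rewrite !inE andbC.
  by rewrite big_mkcondr; apply: eq_bigr => y _; case: (adj x y).
rewrite !sumE exchange_big /=; apply: eq_bigr => y _.
by apply: eq_bigr => x _; rewrite adj_sym.
Qed.

(** * Weights and potentials *)

(** An undominated vertex weighs [undom]; a dominated one weighs 0, [dom1],
[dom2] or [dom3] when it has 0, 1, 2 or at least 3 undominated neighbours.
[drop] is the amount by which each pick must lower the total.  The last five
inequalities are what the five kinds of picks in [exists_heavy_pick] need, in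
the order in which they are tried. *)
Record weighting := Weighting {
  undom : nat;
  dom1 : nat;
  dom2 : nat;
  dom3 : nat;
  drop : nat;
  dom1_gt0 : 0 < dom1;
  dom1_lt : dom1 < dom2;
  dom2_lt : dom2 < dom3;
  dom3_le : dom3 <= undom;
  undom_hub_drop : drop + 4 * dom3 <= 5 * undom;
  undom3_drop : drop + 3 * dom2 <= 4 * undom;
  dom_hub_drop : drop + 4 * dom2 <= 4 * undom + dom3;
  undom2_drop : drop + 2 * dom1 <= 3 * undom + 3;
  dom3_drop : drop + 3 * dom1 <= 3 * undom + dom3 + 3
}.

Definition dom_weight (w : weighting) (k : nat) : nat :=
  match k with 0 => 0 | 1 => dom1 w | 2 => dom2 w | _ => dom3 w end.

Definition potential (w : weighting) (G : sgraph) (U : {set G}) : nat :=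
  undom w * #|U| + \sum_(y in ~: U) dom_weight w (deg_in U y).

Lemma dom_weight_mono (w : weighting) (i j : nat) :
  i <= j -> dom_weight w i <= dom_weight w j.
Proof.
move: (dom1_gt0 w) (dom1_lt w) (dom2_lt w).
by case: i j => [|[|[|i]]] [|[|[|j]]] //=; lia.
Qed.

Lemma dom_weight_le (w : weighting) (k : nat) : dom_weight w k <= dom3 w.
Proof. by apply: leq_trans (dom_weight_mono w (leq_addl 3 k)) _. Qed.

(** Losing an undominated neighbour costs a dominated vertex at least 1, as
long as it starts from at most three of them; beyond three its weight stays
constant. *)
Lemma dom_weight_steep (w : weighting) (i j : nat) :
  i + j <= 3 -> dom_weight w i + j <= dom_weight w (i + j).
Proof.
move: (dom1_gt0 w) (dom1_lt w) (dom2_lt w).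
by case: i j => [|[|[|[|i]]]] [|[|[|[|j]]]] //=; lia.
Qed.

(** The part of the decrease of the potential that is due to the vertices
dominated before X is removed from the undominated set U. *)
Definition loss (w : weighting) (G : sgraph) (U X : {set G}) : nat :=
  \sum_(y in ~: U)
     (dom_weight w (deg_in U y) - dom_weight w (deg_in (U :\: X) y)).

Lemma potential_setD (w : weighting) (G : sgraph) (U X : {set G}) :
  X \subset U ->
  potential w (U :\: X) + undom w * #|X| + loss w U X =
  potential w U + \sum_(x in X) dom_weight w (deg_in (U :\: X) x).
Proof.
move=> XU; rewrite /potential.
have -> : \sum_(y in ~: (U :\: X)) dom_weight w (deg_in (U :\: X) y) =
   \sum_(x in X) dom_weight w (deg_in (U :\: X) x) +
   \sum_(y in ~: U) dom_weight w (deg_in (U :\: X) y).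
  rewrite (big_setID X) /=; congr (_ + _); apply: eq_bigl => y.
    rewrite !inE; have /implyP := subsetP XU y.
    by case: (y \in X); case: (y \in U).
  rewrite !inE; have /implyP := subsetP XU y.
  by case: (y \in X); case: (y \in U).
have -> : \sum_(y in ~: U) dom_weight w (deg_in U y) =
   \sum_(y in ~: U) dom_weight w (deg_in (U :\: X) y) + loss w U X.
  rewrite /loss -big_split /=; apply: eq_bigr => y _.
  by rewrite subnKC // dom_weight_mono // (deg_in_setD _ XU) leq_addr.
rewrite -(cardsID X U) (setIidPr XU) mulnDr; lia.
Qed.

Lemma deg_in_le_loss_term (w : weighting) (G : sgraph) (U X : {set G}) (y : G) :
  X \subset U -> deg_in U y <= 3 ->
  deg_in X y <=
  dom_weight w (deg_in U y) - dom_weight w (deg_in (U :\: X) y).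
Proof.
move=> XU; rewrite (deg_in_setD y XU) => /(dom_weight_steep w); lia.
Qed.

(** * The effect of a pick on the potential *)

(** Each edge between X and a vertex dominated before accounts for a loss of 1,
and counting these edges from the side of X only requires a lower bound on
the degrees there. *)
Lemma incidences_le_loss (w : weighting) (G : sgraph) (U X : {set G}) (m : nat) :
  X \subset U -> {in ~: U, forall y, deg_in U y <= 3} ->
  {in X, forall x, m <= deg_in (~: U) x} ->
  m * #|X| <= loss w U X.
Proof.
move=> XU U3 Xm.
apply: (@leq_trans (\sum_(x in X) deg_in (~: U) x)).
  by rewrite mulnC -sum_nat_const; apply: leq_sum.
rewrite deg_in_double_count; apply: leq_sum => y /U3; exact: deg_in_le_loss_term.
Qed.

Lemma card_closed_nbhdI (G : sgraph) (U : {set G}) (v : G) :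
  #|closed_nbhd v :&: U| = (v \in U) + deg_in U v.
Proof.
rewrite /closed_nbhd -/(nbhd v) setIUl /deg_in; have [vU|vU] := boolP (v \in U).
  by rewrite (setIidPl _) ?sub1set // cardsU1 !inE adj_irrefl.
suff -> : [set v] :&: U = set0 by rewrite set0U.
by apply/setP=> x; rewrite !inE; case: eqVneq => // ->; rewrite (negbTE vU).
Qed.

Lemma deg_in_setD_nbhd (G : sgraph) (U : {set G}) (v : G) :
  deg_in (U :\: closed_nbhd v) v = 0.
Proof. by apply: eq_card0 => x; rewrite !inE; case: (adj v x); rewrite ?orbT ?andbF. Qed.

Lemma dom_weight_le_loss (w : weighting) (G : sgraph) (U : {set G}) (v : G) :
  v \notin U -> dom_weight w (deg_in U v) <= loss w U (closed_nbhd v :&: U).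
Proof.
move=> vU; rewrite /loss (bigD1 v) ?inE //= setDIr setDv setU0.
by rewrite deg_in_setD_nbhd subn0 leq_addr.
Qed.

(** When the picked vertex was already dominated, it loses its whole weight, and
not merely 1 for each of its undominated neighbours. *)
Lemma incidences_le_loss_dominated (w : weighting) (G : sgraph) (U : {set G})
    (v : G) (m : nat) :
  v \notin U -> {in ~: U, forall y, deg_in U y <= 3} ->
  {in U, forall x, m <= deg_in (~: U) x} ->
  m * deg_in U v + dom_weight w (deg_in U v) <=
  loss w U (closed_nbhd v :&: U) + deg_in U v.
Proof.
move=> vU U3 Um; set X := closed_nbhd v :&: U.
have XU : X \subset U by exact: subsetIr.
have cX : #|X| = deg_in U v by rewrite card_closed_nbhdI (negbTE vU).
have dX0 : deg_in (U :\: X) v = 0.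
  by have := deg_in_setD_nbhd U v; rewrite /X setDIr setDv setU0.
have dX : deg_in X v = deg_in U v by rewrite (deg_in_setD v XU) dX0.
have : m * deg_in U v <= \sum_(y in ~: U) deg_in X y.
  rewrite -deg_in_double_count -cX mulnC -sum_nat_const.
  by apply: leq_sum => x /(subsetP XU) /Um.
rewrite /loss !(bigD1 v (P := mem (~: U))) ?inE //= dX dX0 subn0.
set a := \sum_(i in _ | _) _; set b := \sum_(i in _ | _) _.
have : a <= b by apply: leq_sum => y /andP[/U3 y3 _]; exact: deg_in_le_loss_term.
lia.
Qed.

(** The bookkeeping common to all picks.  The new weights are paid for the newly
dominated neighbours of v only: v itself has no undominated neighbour left, so
its weight becomes 0.  If v was undominated, each of these neighbours has also
lost v from its undominated degree, whence the subtracted bit. *)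
Lemma potential_pick (w : weighting) (G : sgraph) (U : {set G}) (v : G) (c : nat) :
  {in U, forall x, adj v x -> dom_weight w (deg_in U x - (v \in U)) <= c} ->
  potential w (U :\: closed_nbhd v) + undom w * #|closed_nbhd v :&: U|
    + loss w U (closed_nbhd v :&: U) <= potential w U + deg_in U v * c.
Proof.
move=> hc; set X := closed_nbhd v :&: U.
have XU : X \subset U by exact: subsetIr.
have -> : U :\: closed_nbhd v = U :\: X by rewrite /X setDIr setDv setU0.
rewrite (potential_setD w XU) leq_add2l.
apply: (@leq_trans (\sum_(x in nbhd v :&: U) c)); last by rewrite sum_nat_const.
have dXv : deg_in (U :\: X) v = 0.
  by have := deg_in_setD_nbhd U v; rewrite /X setDIr setDv setU0.
apply: (@leq_trans (\sum_(x in nbhd v :&: U) dom_weight w (deg_in (U :\: X) x))).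
  rewrite (bigID (pred1 v)) /= big1 ?add0n => [|x /andP[_ /eqP->]]; last by rewrite dXv.
  rewrite (eq_bigl (mem (nbhd v :&: U))) // => x; rewrite !inE.
  by case: eqVneq => [->|]; rewrite ?adj_irrefl ?andbF ?andbT.
apply: leq_sum => x; rewrite !inE => /andP[vx xU].
apply: leq_trans (hc x xU vx); apply: dom_weight_mono.
rewrite (deg_in_setD x XU) -addnBA ?leq_addr //.
case vU: (v \in U) => //; rewrite card_gt0; apply/set0Pn; exists v.
by rewrite !inE eqxx vU adj_sym vx.
Qed.

(** * Picks that dominate at least three new vertices *)

Definition sparse (G : sgraph) (U : {set G}) : bool :=
  [forall v, #|closed_nbhd v :&: U| <= 2].

Lemma sparse_subset (G : sgraph) (U U' : {set G}) :
  U' \subset U -> sparse U -> sparse U'.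
Proof.
move=> sU /forallP spU; apply/forallP => v.
by apply: leq_trans (spU v); apply: subset_leq_card; apply: setIS.
Qed.

(** The pick is the first that exists among: an undominated vertex with at least
four, then three, undominated neighbours; a dominated one with at least four;
an undominated one with two; a dominated one with three.  Each failed
alternative bounds the undominated degrees from above, hence the weights that
the newly dominated vertices receive.  In the last two cases the bounds also
make [dom_weight_steep] available at all dominated vertices, and they leave
each newly dominated vertex with at least one (resp. two) neighbours that were
dominated before. *)
Lemma exists_heavy_pick (G : sgraph) (U : {set G}) :
  3 <= min_degree G -> ~~ sparse U ->
  exists2 v : G, 3 <= #|closed_nbhd v :&: U| &
    forall w, potential w (U :\: closed_nbhd v) + drop w <= potential w U.
Proof.
move=> hG nsU.
have cardX := card_closed_nbhdI U.
have deg_out x := @deg_inC G x U hG.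
case: (boolP [exists v in U, 4 <= deg_in U v]) => [/exists_inP[v vU v4]|].
  exists v => [|w]; first by rewrite cardX; lia.
  have := @potential_pick w G U v (dom3 w) (fun _ _ _ => dom_weight_le w _).
  rewrite cardX vU; have := undom_hub_drop w; have := dom3_le w; nia.
rewrite negb_exists_in => /forall_inP undom_le3.
have deg_le3 x : x \in U -> deg_in U x <= 3 by move/undom_le3; rewrite -ltnNge.
case: (boolP [exists v in U, 3 <= deg_in U v]) => [/exists_inP[v vU v3]|].
  exists v => [|w]; first by rewrite cardX; lia.
  have hc : {in U, forall x, adj v x ->
      dom_weight w (deg_in U x - (v \in U)) <= dom2 w}.
    by move=> x /deg_le3 x3 _; apply: (@dom_weight_mono w _ 2); rewrite vU; lia.
  have := potential_pick hc.
  have -> : deg_in U v = 3 by apply/eqP; rewrite eqn_leq v3 deg_le3.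
  rewrite cardX vU; have := undom3_drop w; have := deg_le3 _ vU; nia.
rewrite negb_exists_in => /forall_inP undom_le2.
have {}deg_le2 x : x \in U -> deg_in U x <= 2 by move/undom_le2; rewrite -ltnNge.
case: (boolP [exists v in ~: U, 4 <= deg_in U v]) => [/exists_inP[v vU v4]|].
  rewrite inE in vU; exists v => [|w]; first by rewrite cardX; lia.
  have hc : {in U, forall x, adj v x ->
      dom_weight w (deg_in U x - (v \in U)) <= dom2 w}.
    by move=> x /deg_le2 x2 _; apply: (@dom_weight_mono w _ 2); lia.
  have := potential_pick hc.
  have := dom_weight_le_loss w vU.
  have := @dom_weight_mono w 3 (deg_in U v) (ltnW v4).
  rewrite cardX (negbTE vU) /=.
  have := dom_hub_drop w; have := dom3_le w; have := dom2_lt w; nia.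
rewrite negb_exists_in => /forall_inP dom_le3.
have {}dom_le3 : {in ~: U, forall y, deg_in U y <= 3}.
  by move=> y /dom_le3; rewrite -ltnNge.
have XU v : closed_nbhd v :&: U \subset U by exact: subsetIr.
case: (boolP [exists v in U, 2 <= deg_in U v]) => [/exists_inP[v vU v2]|].
  exists v => [|w]; first by rewrite cardX; lia.
  have hc : {in U, forall x, adj v x ->
      dom_weight w (deg_in U x - (v \in U)) <= dom1 w}.
    by move=> x /deg_le2 x2 _; apply: (@dom_weight_mono w _ 1); rewrite vU; lia.
  have out1 : {in closed_nbhd v :&: U, forall x, 1 <= deg_in (~: U) x}.
    by move=> x /(subsetP (XU v)) /deg_le2; have := deg_out x; lia.
  have := potential_pick hc; have := incidences_le_loss w (XU v) dom_le3 out1.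
  have -> : deg_in U v = 2 by apply/eqP; rewrite eqn_leq v2 deg_le2.
  rewrite cardX vU; have -> : deg_in U v = 2 by apply/eqP; rewrite eqn_leq v2 deg_le2.
  have := undom2_drop w; lia.
rewrite negb_exists_in => /forall_inP undom_le1.
have {}deg_le1 x : x \in U -> deg_in U x <= 1 by move/undom_le1; rewrite -ltnNge.
have [v v3] : exists v, 3 <= #|closed_nbhd v :&: U|.
  by move: nsU; rewrite negb_forall => /existsP[v]; rewrite -ltnNge; exists v.
have vU : v \notin U by apply/negP => vU; move: v3 (deg_le1 _ vU); rewrite cardX vU; lia.
exists v => // w; move: v3; rewrite cardX (negbTE vU) add0n => v3.
have dUv : deg_in U v = 3 by apply/eqP; rewrite eqn_leq v3 dom_le3 ?inE.
have hc : {in U, forall x, adj v x ->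
    dom_weight w (deg_in U x - (v \in U)) <= dom1 w}.
  by move=> x /deg_le1 x1 _; apply: (@dom_weight_mono w _ 1); lia.
have out2 : {in U, forall x, 2 <= deg_in (~: U) x}.
  by move=> x /deg_le1; have := deg_out x; lia.
have := potential_pick hc; have := incidences_le_loss_dominated w vU dom_le3 out2.
by rewrite cardX (negbTE vU) dUv /=; have := dom3_drop w; lia.
Qed.

Lemma closed_nbhd_setU1 (G : sgraph) (v : G) (S : {set G}) :
  closed_nbhd_set (v |: S) = closed_nbhd v :|: closed_nbhd_set S.
Proof. by rewrite /closed_nbhd_set bigcup_setU big_set1. Qed.

Lemma exists_sparse_remainder (G : sgraph) (U : {set G}) :
  3 <= min_degree G ->
  exists S : {set G}, let U' := U :\: closed_nbhd_set S in
    [/\ sparse U', 3 * #|S| + #|U'| <= #|U| &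
        forall w, drop w * #|S| + potential w U' <= potential w U].
Proof.
move=> hG; have [n leUn] := ubnP #|U|; elim: n U leUn => // n IHn U leUn.
have [spU|/(exists_heavy_pick hG)[v v3 vdrop]] := boolP (sparse U).
  exists set0; rewrite /closed_nbhd_set big_set0 setD0 cards0.
  by split=> // w; rewrite muln0.
have cU := cardsID (closed_nbhd v) U; rewrite setIC in cU.
have [|S [spS cS dropS]] := IHn (U :\: closed_nbhd v); first by lia.
exists (v |: S); rewrite closed_nbhd_setU1 -setDDl.
have cvS : #|v |: S| <= #|S|.+1 by rewrite cardsU1; case: (v \notin S).
split=> // [|w]; first by lia.
have := dropS w; have := vdrop w; nia.
Qed.

(** * The two weightings *)

(** Share the weight of each dominated vertex among its undominated neighbours,
c for each of them. *)
Lemma potential_ge (w : weighting) (G : sgraph) (U : {set G}) (c m : nat) :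
  {in ~: U, forall y, c * deg_in U y <= dom_weight w (deg_in U y)} ->
  {in U, forall x, m <= deg_in (~: U) x} ->
  (undom w + c * m) * #|U| <= potential w U.
Proof.
move=> hc hm; rewrite mulnDl leq_add2l.
apply: (@leq_trans (\sum_(y in ~: U) c * deg_in U y)); last exact: leq_sum.
rewrite -big_distrr /= -deg_in_double_count -mulnA leq_mul2l mulnC -sum_nat_const.
by apply/orP; right; apply: leq_sum.
Qed.

(** With these weights, a pick lowers the potential by twice the share 21 of each
vertex of a sparse undominated set (see [sparse_half_potential]): such a
vertex is charged half a pick. *)
Definition half_weighting : weighting.
Proof. by refine (@Weighting 15 3 6 7 42 _ _ _ _ _ _ _ _ _). Defined.

(** With these weights, the picks that dominate two new vertices, or only one,
can be made to lower the potential by 26 as well, so that it bounds the number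
of picks needed to dominate everything by 11/26 of the order. *)
Definition full_weighting : weighting.
Proof. by refine (@Weighting 11 5 6 7 26 _ _ _ _ _ _ _ _ _). Defined.

(** An undominated vertex has at most one undominated neighbour, hence at least
two dominated ones, each of which can give it 3: together 15 + 2 * 3 = 21. *)
Lemma sparse_half_potential (G : sgraph) (U : {set G}) :
  3 <= min_degree G -> sparse U -> 21 * #|U| <= potential half_weighting U.
Proof.
move=> hG /forallP spU.
apply: (@potential_ge half_weighting _ _ 3 2).
  move=> y; rewrite inE => yU; have := spU y.
  by rewrite card_closed_nbhdI (negbTE yU) add0n; case: (deg_in U y) => [|[|[|]]].
move=> x xU; have := spU x; have := @deg_inC G x U hG.
by rewrite card_closed_nbhdI xU; lia.
Qed.

(** * Spending the remaining picks *)

(** An edge inside U is preferred: the two ends weigh 22 and each of them has two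
neighbours dominated before, which makes 22 + 4 = 26.  If U has no inner edge,
a dominated vertex with two undominated neighbours gives 22 + 6. *)
Lemma exists_pair_pick (G : sgraph) (U : {set G}) (v0 : G) :
  3 <= min_degree G -> sparse U -> 2 <= #|closed_nbhd v0 :&: U| ->
  exists2 v : G, #|closed_nbhd v :&: U| = 2 &
    potential full_weighting (U :\: closed_nbhd v) + 26
      <= potential full_weighting U.
Proof.
move=> hG /forallP spU v02.
have cardX := card_closed_nbhdI U.
have deg_out x := @deg_inC G x U hG.
have dom_le3 : {in ~: U, forall y, deg_in U y <= 3}.
  by move=> y; rewrite inE => /negbTE yU; have := spU y; rewrite cardX yU; lia.
case: (boolP [exists v in U, 0 < deg_in U v]) => [/exists_inP[v vU v1]|].
  have deg_le1 x : x \in U -> deg_in U x <= 1.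
    by move=> xU; have := spU x; rewrite cardX xU; lia.
  have dUv : deg_in U v = 1 by apply/eqP; rewrite eqn_leq v1 deg_le1.
  exists v; first by rewrite cardX vU dUv.
  have hc : {in U, forall x, adj v x ->
      dom_weight full_weighting (deg_in U x - (v \in U)) <= 0}.
    move=> x /deg_le1 x1 _; apply: (@dom_weight_mono full_weighting _ 0).
    by rewrite vU; lia.
  have XU : closed_nbhd v :&: U \subset U by exact: subsetIr.
  have out2 : {in closed_nbhd v :&: U, forall x, 2 <= deg_in (~: U) x}.
    by move=> x /(subsetP XU) /deg_le1; have := deg_out x; lia.
  have := potential_pick hc.
  have := incidences_le_loss full_weighting XU dom_le3 out2.
  by rewrite cardX vU dUv /=; lia.
rewrite negb_exists_in => /forall_inP undom0.
have deg0 x : x \in U -> deg_in U x = 0 by move/undom0; case: (deg_in U x).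
have vU : v0 \notin U.
  by apply/negP => vU; move: v02; rewrite cardX vU deg0.
have dUv : deg_in U v0 = 2.
  by apply/eqP; have := spU v0; move: v02; rewrite cardX (negbTE vU) eqn_leq => -> ->.
exists v0; first by rewrite cardX (negbTE vU) dUv.
have hc : {in U, forall x, adj v0 x ->
    dom_weight full_weighting (deg_in U x - (v0 \in U)) <= 0}.
  by move=> x /deg0 -> _.
have := potential_pick hc; have := dom_weight_le_loss full_weighting vU.
by rewrite cardX (negbTE vU) dUv /=; lia.
Qed.

(** Here the closed neighbourhoods of the vertices of U are disjoint, and each
consists of a vertex of weight 11 and at least three dominated vertices of
weight 5: together 11 + 3 * 5 = 26. *)
Lemma packing_full_potential (G : sgraph) (U : {set G}) :
  3 <= min_degree G -> (forall v, #|closed_nbhd v :&: U| <= 1) ->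
  26 * #|U| <= potential full_weighting U.
Proof.
move=> hG pU; apply: (@potential_ge full_weighting _ _ 5 3).
  move=> y; rewrite inE => yU; have := pU y.
  by rewrite card_closed_nbhdI (negbTE yU) add0n; case: (deg_in U y) => [|[|]].
move=> x xU; have := pU x; have := @deg_inC G x U hG.
by rewrite card_closed_nbhdI xU; lia.
Qed.

(** With a budget of r picks, either all of them dominate two new vertices, or
the picks of this kind run out and the second potential takes over, or
everything gets dominated. *)
Lemma exists_budget_cover (G : sgraph) (U : {set G}) (r : nat) :
  3 <= min_degree G -> sparse U ->
  exists2 S : {set G}, #|S| <= r & let u := #|U :\: closed_nbhd_set S| in
    [\/ u + 2 * r <= #|U|,
        26 * (u + r) <= potential full_weighting U | u = 0].
Proof.
move=> hG; elim: r U => [|r IHr] U spU.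
  exists set0; rewrite ?cards0 // /closed_nbhd_set big_set0 setD0 addn0.
  by constructor 1.
case: (boolP [exists v, 2 <= #|closed_nbhd v :&: U|]) => [/existsP[v0 v02]|].
  have [v v2 vdrop] := exists_pair_pick hG spU v02.
  have [S Sr uS] := IHr _ (sparse_subset (subsetDl U (closed_nbhd v)) spU).
  have cU := cardsID (closed_nbhd v) U; rewrite setIC v2 in cU.
  have cvS : #|v |: S| <= #|S|.+1 by rewrite cardsU1; case: (v \notin S).
  exists (v |: S); first by lia.
  rewrite closed_nbhd_setU1 -setDDl; move: uS => /=.
  by case=> H; [constructor 1|constructor 2|constructor 3]; lia.
rewrite negb_exists => /forallP pU.
have {}pU v : #|closed_nbhd v :&: U| <= 1 by rewrite leqNgt.
have full := packing_full_potential hG pU.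
have dominates (S : {set G}) : S \subset closed_nbhd_set S.
  by apply/subsetP=> x xS; apply/bigcupP; exists x; rewrite ?inE ?eqxx.
have [leUr|ltrU] := leqP #|U| r.+1.
  exists U => //; constructor 3; apply/eqP.
  by rewrite cards_eq0 setD_eq0.
(* No pick dominates two vertices of U any more: any r.+1 vertices of U do. *)
have [S SU cS] : exists2 S : {set G}, S \subset U & #|S| = r.+1.
  have [s [us <- sU]] := card_geqP (ltnW ltrU).
  exists [set x in s]; first by apply/subsetP=> x; rewrite inE => /sU.
  by rewrite cardsE; apply/card_uniqP.
exists S; rewrite ?cS //; constructor 2.
apply: leq_trans full; rewrite leq_mul2l /=.
have := subset_leq_card (setDS U (dominates S)).
by have := cardsID S U; rewrite (setIidPr SU) cS; lia.
Qed.

Lemma exists_small_cover (G : sgraph) :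
  60 <= #|G| -> 3 <= min_degree G ->
  exists S : {set G}, 3 * #|S| <= #|G| /\ 10 * #|~: closed_nbhd_set S| <= #|G|.
Proof.
move=> n60 hG.
have potT w : potential w [set: G] = undom w * #|G|.
  by rewrite /potential setCT big_set0 addn0 cardsT.
have [S1 [sp1]] := exists_sparse_remainder [set: G] hG.
set U := _ :\: _ in sp1 *; rewrite cardsT => c1 drop1.
have := drop1 half_weighting; have := drop1 full_weighting.
rewrite !potT /= => full1 half1.
have half2 := sparse_half_potential hG sp1.
have [q3 q3'] : 3 * (#|G| %/ 3) <= #|G| /\ #|G| < 3 * (#|G| %/ 3) + 3 by lia.
move: (_ %/ 3) q3 q3' => q q3 q3'.
have [S2 c2 u2] := exists_budget_cover (q - #|S1|) hG sp1.
exists (S1 :|: S2).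
have cS : #|S1 :|: S2| <= #|S1| + #|S2| by rewrite -cardsUI leq_addr.
have -> : ~: closed_nbhd_set (S1 :|: S2) = U :\: closed_nbhd_set S2.
  by rewrite /closed_nbhd_set bigcup_setU setCU /U setTD setDE.
move: n60 c1 c2 cS q3 q3' half1 half2 full1 u2 => /=.
move: (potential _ U) (potential _ U) #|U :\: _| #|U| #|S1 :|: S2| => p1 p2 u2 u1 s.
move: #|S1| #|S2| #|G| => s1 s2 n n60 c1 c2 cS q3 q3' half1 half2 full1 u2_cases.
have sq : s1 <= q by lia.
by case: u2_cases => u2_le; split; lia.
Qed.

Theorem theorem4p4 (G : sgraph) (n : nat) (order_G : #|G| = n)
    (n_ge60 : 60 <= n) (min_degree_ge3 : 3 <= min_degree G) :
  ((pd (9 / 10 : rat) G)%:R <= 1 / 3 * n%:R :> rat)%R.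
Proof.
move: n_ge60; rewrite -order_G => n60.
have alpha_le1 : (9 / 10 <= 1 :> rat)%R by lra.
have [S [cS cU]] := exists_small_cover n60 min_degree_ge3.
have pdS : partial_dominating (9 / 10 : rat)%R S.
  have cn := cardsC (closed_nbhd_set S).
  have : 9 * #|G| <= 10 * #|closed_nbhd_set S| by lia.
  by rewrite /partial_dominating -(ler_nat rat) !natrM; lra.
have : 3 * pd (9 / 10 : rat)%R G <= #|G|.
  by apply: leq_trans cS; exact: leq_mul (leqnn 3) (pd_le alpha_le1 pdS).
by rewrite -(ler_nat rat) natrM; lra.
Qed.
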